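(* Let $\mathcal{R}:T\to\mathbf{Rep}_{\mathbb{K}}$ be a persistence representation, $\mathcal{R}_t=(G_t,V_t,\rho_t)$, and let $s\leq t$ in $T$. Let $W_s\subseteq V_s$ be an irreducible $G_s$-invariant subspace. Then the $G_s$-invariant subspace $W_{s,t}=f_{s,t}(W_s)$ of $V_{s,t}=f_{s,t}(V_s)$ is either irreducible or the zero space.
   Context: $\mathbb{K}$ is a field of characteristic zero. $\mathbf{Rep}_{\mathbb{K}}$ is the category whose objects are triples $(G,V,\rho)$ with $G$ a finite group, $V$ a finite-dimensional $\mathbb{K}$-vector space and $\rho:G\to\mathrm{GL}(V)$ a homomorphism, and whose morphisms $(G,V,\rho)\to(G',V',\rho')$ are pairs $(\phi,f)$ with $\phi:G\to G'$ a group homomorphism and $f:V\to V'$ linear such that $f(\rho(g)v)=\rho'(\phi(g))f(v)$ for all $g\in G$, $v\in V$. For a poset $(T,\leq)$ viewed as a category, a persistence representation is a functor $\mathcal{R}:T\to\mathbf{Rep}_{\mathbb{K}}$, with structure morphisms $(\phi_{s,t},f_{s,t}):\mathcal{R}_s\to\mathcal{R}_t$ for $s\leq t$. The group $G_s$ acts on $V_{s,t}=f_{s,t}(V_s)\subseteq V_t$ by $\rho_{s,t}(g)(v)=\rho_t(\phi_{s,t}(g))(v)$; invariance and irreducibility of $W_{s,t}$ are with respect to this action. *)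

(* Defs.v *)
From HB Require Import structures.
From mathcomp Require Import all_boot all_order all_algebra all_fingroup.

Set Implicit Arguments.
Unset Strict Implicit.
Unset Printing Implicit Defensive.

Import Order.TTheory GRing.Theory.
Local Open Scope ring_scope.

Section GeneralLinear.
Variables (K : fieldType) (V : vectType K).

(* Since V is finite-dimensional, a linear endomorphism is invertible iff its
   kernel is trivial. The zero space is allowed. *)
Record GL := MkGL { glval :> 'End(V); glP : lker glval == 0%VS }.

HB.instance Definition _ := [isSub for glval].
HB.instance Definition _ := [Choice of GL by <:].

Fact gl1_subproof : lker (\1%VF : 'End(V)) == 0%VS.
Proof. by apply/lker0P => x y; rewrite !id_lfunE. Qed.

Fact glM_subproof (f g : GL) : lker (f \o g)%VF == 0%VS.
Proof.
apply/lker0P => x y; rewrite !comp_lfunE => /(lker0P (glP f)).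
exact: (lker0P (glP g)).
Qed.

Fact glV_subproof (f : GL) : lker (f^-1)%VF == 0%VS.
Proof.
apply/lker0P => x y e.
by rewrite -(lker0_lfunVK (glP f) x) e lker0_lfunVK ?glP.
Qed.

Definition gl1 := MkGL gl1_subproof.
Definition glM f g := MkGL (glM_subproof f g).
Definition glV f := MkGL (glV_subproof f).

Fact glMA : associative glM.
Proof. by move=> f g h; apply/val_inj; rewrite /= comp_lfunA. Qed.
Fact gl1M : left_id gl1 glM.
Proof. by move=> f; apply/val_inj; rewrite /= comp_lfun1l. Qed.
Fact glM1 : right_id gl1 glM.
Proof. by move=> f; apply/val_inj; rewrite /= comp_lfun1r. Qed.
Fact glVM : left_inverse gl1 glV glM.
Proof. by move=> f; apply/val_inj; rewrite /= lker0_compVf ?glP. Qed.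
Fact glMV : right_inverse gl1 glV glM.
Proof. by move=> f; apply/val_inj; rewrite /= lker0_compfV ?glP. Qed.

HB.instance Definition _ := isGroup.Build GL glMA gl1M glM1 glVM glMV.

End GeneralLinear.

Section Rep.
Variable K : fieldType.

Record rep := Rep {
  rep_group : finGroupType;
  rep_space : vectType K;
  rep_act : {multiplicative rep_group -> GL rep_space}
}.

Record rep_hom (A B : rep) := RepHom {
  hom_group : {multiplicative rep_group A -> rep_group B};
  hom_space : 'Hom(rep_space A, rep_space B);
  hom_equivariant : forall g v,
    hom_space (rep_act A g v) = rep_act B (hom_group g) (hom_space v)
}.

(* Equality of morphisms, taken componentwise and pointwise so as not to depend
   on functional extensionality or on the equivariance proofs. *)
Definition rep_hom_eq A B (h k : rep_hom A B) : Prop :=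
  hom_group h =1 hom_group k /\ hom_space h = hom_space k.

Fact rep_id_equivariant A g v :
  (\1%VF : 'End(rep_space A)) (rep_act A g v)
    = rep_act A (idfun g) ((\1%VF : 'End(rep_space A)) v).
Proof. by rewrite !id_lfunE. Qed.

Definition rep_id A : rep_hom A A := RepHom (@rep_id_equivariant A).

Fact rep_comp_equivariant A B C (k : rep_hom B C) (h : rep_hom A B) g v :
  (hom_space k \o hom_space h)%VF (rep_act A g v)
    = rep_act C ((hom_group k \o hom_group h) g)
        ((hom_space k \o hom_space h)%VF v).
Proof. by rewrite !comp_lfunE !hom_equivariant. Qed.

Definition rep_comp A B C (k : rep_hom B C) (h : rep_hom A B) : rep_hom A C :=
  RepHom (rep_comp_equivariant k h).

End Rep.

Record persistence_rep (K : fieldType) (disp : Order.disp_t)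
    (T : porderType disp) := PersistenceRep {
  pers_obj :> T -> rep K;
  pers_map : forall s t : T, (s <= t)%O -> rep_hom (pers_obj s) (pers_obj t);
  pers_map_id : forall s : T,
    rep_hom_eq (pers_map (lexx s)) (rep_id (pers_obj s));
  pers_map_comp : forall (s t u : T) (st : (s <= t)%O) (tu : (t <= u)%O),
    rep_hom_eq (pers_map (le_trans st tu)) (rep_comp (pers_map tu) (pers_map st))
}.

Section Invariance.
Variables (K : fieldType) (G : finGroupType) (V : vectType K).
Variable rho : {multiplicative G -> GL V}.

Definition invariant_space (W : {vspace V}) : Prop :=
  forall g v, v \in W -> rho g v \in W.

Definition irreducible_space (W : {vspace V}) : Prop :=
  [/\ invariant_space W, W != 0%VS &
      forall U : {vspace V}, (U <= W)%VS -> invariant_space U ->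
        U = 0%VS \/ U = W].

End Invariance.

Section Structure.
Variables (K : fieldType) (disp : Order.disp_t) (T : porderType disp).
Variables (R : persistence_rep K T) (s t : T) (st : (s <= t)%O).

Definition pers_image : {vspace rep_space (R t)} :=
  limg (hom_space (pers_map R st)).

(* The action of G_s on V_{s,t}, given by the formula for it on all of V_t;
   pers_image_invariant shows that it preserves V_{s,t}. *)
Definition pers_act :
    {multiplicative rep_group (R s) -> GL (rep_space (R t))} :=
  rep_act (R t) \o hom_group (pers_map R st).

Lemma pers_image_invariant : invariant_space pers_act pers_image.
Proof.
move=> g _ /memv_imgP[v _ ->].
by rewrite /= -hom_equivariant memv_img ?memvf.
Qed.

Definition pers_sub_image (W : {vspace rep_space (R s)}) :
    {vspace rep_space (R t)} := (hom_space (pers_map R st) @: W)%VS.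

End Structure.

Arguments pers_image {K disp T} R {s t} st.
Arguments pers_act {K disp T} R {s t} st.
Arguments pers_sub_image {K disp T} R {s t} st W.

(* Main.v *)
Require Import Defs.
From HB Require Import structures.
From mathcomp Require Import all_boot all_order all_algebra all_fingroup.

(** An equivariant linear map [f] carries invariant subspaces to invariant
    subspaces, and pulls them back to invariant subspaces. If [W] is irreducible
    and [U] is an invariant subspace of [f @: W], then [W :&: f @^-1: U] is an
    invariant subspace of [W] whose image is [U]; being 0 or [W], it forces [U]
    to be 0 or [f @: W] ([irreducible_limg]). A structure map of a persistence
    representation is equivariant for the two actions of [G_s], so the
    proposition is the instance of this fact at that map. *)

Section EquivariantMap.

Variables (K : fieldType) (G : finGroupType) (V V' : vectType K).
Variables (rho : {multiplicative G -> GL V}) (rho' : {multiplicative G -> GL V'}).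
Variable f : 'Hom(V, V').
Hypothesis f_equiv : forall g v, f (rho g v) = rho' g (f v).

Lemma invariant_limg (W : {vspace V}) :
  invariant_space rho W -> invariant_space rho' (f @: W)%VS.
Proof.
by move=> invW g _ /memv_imgP[v Wv ->]; rewrite -f_equiv memv_img ?invW.
Qed.

Lemma invariant_cap_lpreim (W : {vspace V}) (U : {vspace V'}) :
  invariant_space rho W -> invariant_space rho' U ->
  invariant_space rho (W :&: f @^-1: U)%VS.
Proof.
move=> invW invU g v; rewrite !memv_cap -!memv_preim => /andP[Wv Ufv].
by rewrite invW //= f_equiv invU.
Qed.

Lemma limg_cap_lpreim (W : {vspace V}) (U : {vspace V'}) :
  (U <= f @: W)%VS -> (f @: (W :&: f @^-1: U))%VS = U.
Proof.
move=> sUfW; apply/eqP; rewrite eqEsubv; apply/andP; split; apply/subvP => u.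
  by case/memv_imgP=> v; rewrite memv_cap -memv_preim => /andP[_ Ufv] ->.
move=> Uu; have /memv_imgP[v Wv def_u] := subvP sUfW u Uu.
by rewrite def_u memv_img // memv_cap Wv -memv_preim -def_u.
Qed.

(** The invariant subspaces of [f @: W] correspond to those of [W] that contain
    the kernel of [f] on [W], and irreducibility leaves at most 0 and [W]. The
    image vanishes when [W] itself is that kernel. *)
Lemma irreducible_limg (W : {vspace V}) :
  irreducible_space rho W ->
  irreducible_space rho' (f @: W)%VS \/ (f @: W)%VS = 0%VS.
Proof.
case=> invW _ minW.
have [-> | fW_neq0] := eqVneq (f @: W)%VS 0%VS; first by right.
left; split=> // [|U sUfW invU]; first exact: invariant_limg.
rewrite -(limg_cap_lpreim _ _ sUfW).
have [-> | ->] := minW _ (capvSl W _) (invariant_cap_lpreim _ _ invW invU).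
  by left; rewrite limg0.
by right.
Qed.

End EquivariantMap.

Theorem proposition3p1p1 (K : fieldType) (charK : [pchar K]%R =i pred0)
    (disp : Order.disp_t) (T : porderType disp) (R : persistence_rep K T)
    (s t : T) (st : (s <= t)%O) (W : {vspace rep_space (R s)}) :
  irreducible_space (rep_act (R s)) W ->
  [/\ (pers_sub_image R st W <= pers_image R st)%VS,
      invariant_space (pers_act R st) (pers_sub_image R st W) &
      irreducible_space (pers_act R st) (pers_sub_image R st W)
        \/ pers_sub_image R st W = 0%VS].
Proof.
move=> irrW; have [invW _ _] := irrW.
have f_equiv g v : hom_space (pers_map R st) (rep_act (R s) g v)
    = pers_act R st g (hom_space (pers_map R st) v).
  exact: hom_equivariant.
split; first exact: limgS (subvf W).
  exact: invariant_limg f_equiv _ invW.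
exact: irreducible_limg f_equiv _ irrW.
Qed.
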